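(* Let $\Gamma$ be a set. The Banach space $\ell_1(\Gamma)$ endowed with its weak topology is an $\aleph$-space if and only if $|\Gamma|\le 2^{\aleph_0}$.
   Context: A family $\mathcal N$ of subsets of a topological space $Y$ is a $k$-network if whenever $K\subset U$ with $K$ compact and $U$ open in $Y$, there is a finite $\mathcal F\subset\mathcal N$ with $K\subset\bigcup\mathcal F\subset U$. A space is an $\aleph$-space if it is regular and has a $\sigma$-locally finite $k$-network. *)

(* Defs.v *)
From Stdlib Require Import Reals List.
Open Scope R_scope.

Definition subset {X : Type} (A B : X -> Prop) : Prop := forall x, A x -> B x.

Definition union_list {X : Type} (l : list (X -> Prop)) : X -> Prop :=
  fun x => exists A, In A l /\ A x.

Definition is_topology {X : Type} (open : (X -> Prop) -> Prop) : Prop :=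
  open (fun _ => True) /\ open (fun _ => False) /\
  (forall U V, open U -> open V -> open (fun x => U x /\ V x)) /\
  (forall C : (X -> Prop) -> Prop, (forall U, C U -> open U) ->
     open (fun x => exists U, C U /\ U x)).

Definition closed {X : Type} (open : (X -> Prop) -> Prop) (F : X -> Prop) : Prop :=
  open (fun x => ~ F x).

Definition regular {X : Type} (open : (X -> Prop) -> Prop) : Prop :=
  forall (x : X) (F : X -> Prop), closed open F -> ~ F x ->
    exists U V, open U /\ open V /\ U x /\ subset F V /\
      (forall y, U y -> V y -> False).

Definition compact {X : Type} (open : (X -> Prop) -> Prop) (K : X -> Prop) : Prop :=
  forall C : (X -> Prop) -> Prop,
    (forall U, C U -> open U) ->
    subset K (fun x => exists U, C U /\ U x) ->
    exists l : list (X -> Prop), (forall U, In U l -> C U) /\ subset K (union_list l).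

Definition k_network {X : Type} (open : (X -> Prop) -> Prop)
  (N : (X -> Prop) -> Prop) : Prop :=
  forall K U, compact open K -> open U -> subset K U ->
    exists l : list (X -> Prop), (forall A, In A l -> N A) /\
      subset K (union_list l) /\ subset (union_list l) U.

Definition locally_finite {X : Type} (open : (X -> Prop) -> Prop)
  (F : (X -> Prop) -> Prop) : Prop :=
  forall x : X, exists V, open V /\ V x /\
    exists l : list (X -> Prop),
      forall A, F A -> (exists y, V y /\ A y) -> In A l.

Definition sigma_locally_finite {X : Type} (open : (X -> Prop) -> Prop)
  (N : (X -> Prop) -> Prop) : Prop :=
  exists Ns : nat -> ((X -> Prop) -> Prop),
    (forall n, locally_finite open (Ns n)) /\
    (forall A, N A <-> exists n, Ns n A).

Definition aleph_space {X : Type} (open : (X -> Prop) -> Prop) : Prop :=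
  regular open /\
  exists N : (X -> Prop) -> Prop, sigma_locally_finite open N /\ k_network open N.

Fixpoint abs_sum {G : Type} (x : G -> R) (l : list G) : R :=
  match l with
  | nil => 0
  | g :: l' => Rabs (x g) + abs_sum x l'
  end.

Definition is_l1 {G : Type} (x : G -> R) : Prop :=
  exists M, forall l : list G, NoDup l -> abs_sum x l <= M.

Definition l1 (G : Type) : Type := { x : G -> R | is_l1 x }.

(* ||x||_1 < d, where ||x||_1 = sup over finite sets of sum |x g| *)
Definition l1norm_lt {G : Type} (x : G -> R) (d : R) : Prop :=
  exists d', d' < d /\ forall l : list G, NoDup l -> abs_sum x l <= d'.

Definition linear_functional {G : Type} (f : l1 G -> R) : Prop :=
  (forall x y z : l1 G, (forall g, proj1_sig z g = proj1_sig x g + proj1_sig y g) ->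
      f z = f x + f y) /\
  (forall (c : R) (x z : l1 G), (forall g, proj1_sig z g = c * proj1_sig x g) ->
      f z = c * f x).

Definition norm_continuous {G : Type} (f : l1 G -> R) : Prop :=
  forall (x : l1 G) (eps : R), 0 < eps -> exists delta, 0 < delta /\
    forall y : l1 G,
      l1norm_lt (fun g => proj1_sig y g - proj1_sig x g) delta ->
      Rabs (f y - f x) < eps.

Definition cont_linear_functional {G : Type} (f : l1 G -> R) : Prop :=
  linear_functional f /\ norm_continuous f.

Definition weak_open {G : Type} (U : l1 G -> Prop) : Prop :=
  forall x, U x -> exists (fs : list (l1 G -> R)) (eps : R),
    (forall f, In f fs -> cont_linear_functional f) /\ 0 < eps /\
    forall y, (forall f, In f fs -> Rabs (f y - f x) < eps) -> U y.

Definition card_le_continuum (G : Type) : Prop :=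
  exists i : G -> (nat -> bool), forall a b, i a = i b -> a = b.

(* Main.v *)
From Stdlib Require Import Reals Arith List Lra Lia Permutation Classical ClassicalEpsilon.
From Stdlib Require Import FunctionalExtensionality Cantor.
Require Import Defs.

(* If the weak topology has a sigma-locally finite k-network, local finiteness at [0] makes
   [{0}] a weak G_delta, so countably many functionals separate points and
   [g |-> (f_n (e_g))_n] embeds [Gamma] into [R^nat].

   Conversely, identify [Gamma] with a subset of [2^nat].  Around a finitely supported center
   with values in [(1/t) Z] take the vectors that are close to it in norm and, moreover, have
   almost all their mass on each support point's level-[m] cylinder concentrated at that
   point.  The finitely many functionals "sum over a cylinder", together with finitely many
   coordinates, show that such cells are weakly locally finite for fixed parameters.  They
   contain norm neighbourhoods, and they form a k-network because weakly compact sets are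
   norm compact: a gliding hump argument gives uniformly small tails. *)

Lemma choice_function {A B : Type} (P : A -> B -> Prop) :
  (forall a, exists b, P a b) -> exists f, forall a, P a (f a).
Proof.
  intros H. exists (fun a => proj1_sig (constructive_indefinite_description _ (H a))).
  intros a. apply proj2_sig.
Qed.

(** * Finite sums and masses *)

Definition lsum {G : Type} (a : G -> R) (l : list G) : R :=
  fold_right (fun g s => a g + s) 0 l.

Definition select {G : Type} (P : G -> Prop) : list G -> list G :=
  filter (fun g => if excluded_middle_informative (P g) then true else false).

(** An upper bound for the $\ell_1$ mass of [x] on [P], quantified over finite duplicate-free lists
    so that no infinite sum occurs. Most norm estimates below take this form. *)
Definition mass_le {G : Type} (P : G -> Prop) (x : G -> R) (c : R) : Prop :=
  forall l, NoDup l -> (forall g, In g l -> P g) -> abs_sum x l <= c.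

Lemma in_select {G : Type} (P : G -> Prop) l g :
  In g (select P l) <-> In g l /\ P g.
Proof.
  unfold select; rewrite filter_In.
  destruct (excluded_middle_informative (P g)); intuition discriminate.
Qed.

Lemma NoDup_select {G : Type} (P : G -> Prop) l : NoDup l -> NoDup (select P l).
Proof. apply NoDup_filter. Qed.

Lemma lsum_select {G : Type} (P : G -> Prop) (a : G -> R) l :
  lsum a l = lsum a (select P l) + lsum a (select (fun g => ~ P g) l).
Proof.
  induction l as [|g l IH]; simpl; [lra|].
  destruct (excluded_middle_informative (P g));
    destruct (excluded_middle_informative (~ P g)); try tauto; simpl; lra.
Qed.

Lemma lsum_perm {G : Type} (a : G -> R) l l' :
  Permutation l l' -> lsum a l = lsum a l'.
Proof. induction 1; simpl; lra. Qed.

Lemma lsum_app {G : Type} (a : G -> R) l l' : lsum a (l ++ l') = lsum a l + lsum a l'.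
Proof. induction l; simpl; lra. Qed.

Lemma lsum_lin {G : Type} (a b : G -> R) (c d : R) l :
  lsum (fun g => c * a g + d * b g) l = c * lsum a l + d * lsum b l.
Proof. induction l; simpl; lra. Qed.

Lemma lsum_le {G : Type} (a b : G -> R) l :
  (forall g, In g l -> a g <= b g) -> lsum a l <= lsum b l.
Proof.
  induction l as [|g l IH]; simpl; intros H; [lra|].
  pose proof (H g (or_introl eq_refl)).
  assert (lsum a l <= lsum b l) by (apply IH; auto). lra.
Qed.

Lemma lsum_const {G : Type} (c : R) (l : list G) : lsum (fun _ => c) l = INR (length l) * c.
Proof. induction l as [|g l IH]; [simpl; lra|]. cbn [length]. rewrite S_INR; simpl. lra. Qed.

Lemma abs_sum_lsum {G : Type} (a : G -> R) l : abs_sum a l = lsum (fun g => Rabs (a g)) l.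
Proof. induction l; simpl; congruence. Qed.

Lemma abs_sum_ge0 {G : Type} (a : G -> R) l : 0 <= abs_sum a l.
Proof. induction l as [|g l]; simpl; [lra|]. pose proof (Rabs_pos (a g)); lra. Qed.

Lemma abs_sum_le {G : Type} (a b : G -> R) l :
  (forall g, In g l -> Rabs (a g) <= Rabs (b g)) -> abs_sum a l <= abs_sum b l.
Proof. intros; rewrite !abs_sum_lsum; now apply lsum_le. Qed.

Lemma Rabs_lsum_le {G : Type} (a : G -> R) l : Rabs (lsum a l) <= abs_sum a l.
Proof.
  induction l as [|g l IH]; simpl; [rewrite Rabs_R0; lra|].
  pose proof (Rabs_triang (a g) (lsum a l)); lra.
Qed.

Lemma abs_sum_triang {G : Type} (x y z : G -> R) l :
  (forall g, In g l -> Rabs (x g) <= Rabs (y g) + Rabs (z g)) ->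
  abs_sum x l <= abs_sum y l + abs_sum z l.
Proof.
  induction l as [|g l IH]; simpl; intros H; [lra|].
  pose proof (H g (or_introl eq_refl)).
  assert (abs_sum x l <= abs_sum y l + abs_sum z l) by (apply IH; auto). lra.
Qed.

Lemma lsum_incl_split {G : Type} (a : G -> R) S l :
  NoDup S -> NoDup l -> incl S l ->
  lsum a l = lsum a S + lsum a (select (fun g => ~ In g S) l).
Proof.
  intros HS Hl HSl. rewrite (lsum_select (fun g => In g S)). f_equal.
  apply lsum_perm, NoDup_Permutation; auto using NoDup_select.
  intros g; rewrite in_select; split; intuition.
Qed.

Lemma mass_le_weaken {G : Type} (P Q : G -> Prop) x y c d :
  mass_le Q y d -> (forall g, P g -> Q g) -> (forall g, P g -> Rabs (x g) <= Rabs (y g)) ->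
  d <= c -> mass_le P x c.
Proof.
  intros H PQ xy dc l Hl HP.
  apply Rle_trans with (abs_sum y l); [apply abs_sum_le; auto|].
  apply Rle_trans with d; auto.
Qed.

Lemma mass_le_split {G : Type} (Q P : G -> Prop) x a b :
  mass_le (fun g => P g /\ Q g) x a -> mass_le (fun g => P g /\ ~ Q g) x b ->
  mass_le P x (a + b).
Proof.
  intros Ha Hb l Hl HP. rewrite abs_sum_lsum, (lsum_select Q), <- !abs_sum_lsum.
  apply Rplus_le_compat; [apply Ha|apply Hb]; auto using NoDup_select;
    intros g; rewrite in_select; intuition.
Qed.

Lemma mass_le_triang {G : Type} (P : G -> Prop) x y z a b :
  mass_le P y a -> mass_le P z b ->
  (forall g, P g -> Rabs (x g) <= Rabs (y g) + Rabs (z g)) -> mass_le P x (a + b).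
Proof.
  intros Ha Hb H l Hl HP. apply Rle_trans with (abs_sum y l + abs_sum z l).
  - apply abs_sum_triang; auto.
  - apply Rplus_le_compat; auto.
Qed.

Lemma mass_le_finite {G : Type} (S : list G) (P : G -> Prop) x e :
  0 <= e -> (forall g, P g -> In g S) -> (forall g, P g -> Rabs (x g) <= e) ->
  mass_le P x (INR (length S) * e).
Proof.
  intros He PS Hx l Hl HP. rewrite abs_sum_lsum.
  apply Rle_trans with (lsum (fun _ => e) l); [apply lsum_le; auto|].
  rewrite lsum_const. apply Rmult_le_compat_r; auto.
  apply le_INR, NoDup_incl_length; auto. intros g Hg; auto.
Qed.

Lemma mass_le_zero {G : Type} (P : G -> Prop) x c :
  0 <= c -> (forall g, P g -> x g = 0) -> mass_le P x c.
Proof.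
  intros Hc Hx l _ Hl. apply Rle_trans with (lsum (fun _ => 0) l).
  - rewrite abs_sum_lsum. apply lsum_le. intros g Hg. rewrite Hx, Rabs_R0; auto; lra.
  - rewrite lsum_const; lra.
Qed.

(** * Unordered sums *)

Lemma is_l1_mass {G : Type} (x : G -> R) : is_l1 x <-> exists M, mass_le (fun _ => True) x M.
Proof. split; intros [M H]; exists M; intros l Hl; auto. Qed.

Lemma l1norm_lt_mass {G : Type} (x : G -> R) d :
  l1norm_lt x d <-> exists d', d' < d /\ mass_le (fun _ => True) x d'.
Proof. split; intros (d' & Hd & H); exists d'; split; auto; intros l Hl; auto. Qed.

Lemma is_l1_triang {G : Type} (x y z : G -> R) :
  is_l1 y -> is_l1 z -> (forall g, Rabs (x g) <= Rabs (y g) + Rabs (z g)) -> is_l1 x.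
Proof.
  rewrite !is_l1_mass. intros [a Ha] [b Hb] H. exists (a + b).
  apply (mass_le_triang _ x y z); auto.
Qed.

Lemma is_l1_le {G : Type} (x y : G -> R) :
  is_l1 y -> (forall g, Rabs (x g) <= Rabs (y g)) -> is_l1 x.
Proof.
  intros Hy H. apply (is_l1_triang x y y); auto.
  intros g. pose proof (H g); pose proof (Rabs_pos (y g)); lra.
Qed.

Lemma is_l1_minus {G : Type} (x y : G -> R) :
  is_l1 x -> is_l1 y -> is_l1 (fun g => x g - y g).
Proof.
  intros Hx Hy. apply (is_l1_triang _ x y); auto.
  intros g. unfold Rminus. rewrite <- (Rabs_Ropp (y g)). apply Rabs_triang.
Qed.

(** Choose a finite [S] whose sum comes within [eps] of the supremum [L] of all finite sums: a
    disjoint list of mass above [eps] would push the total beyond [L]. *)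
Lemma small_tail {G : Type} (x : G -> R) eps :
  is_l1 x -> 0 < eps -> exists S, NoDup S /\ mass_le (fun g => ~ In g S) x eps.
Proof.
  intros [M HM] He.
  destruct (completeness (fun s => exists l, NoDup l /\ s = abs_sum x l)) as [L [Lub Lleast]].
  - exists M. intros s (l & Hl & ->); auto.
  - exists 0, nil; split; [constructor|reflexivity].
  - apply NNPP; intros Hn.
    assert (Hb : L <= L - eps); [|lra].
    apply Lleast. intros s (S & HS & ->).
    destruct (Rle_or_lt (abs_sum x S) (L - eps)) as [|Hlt]; auto.
    exfalso; apply Hn. exists S; split; auto. intros l Hl Hdis.
    assert (abs_sum x (S ++ l) <= L).
    { apply Lub. exists (S ++ l); split; auto. apply NoDup_app; auto.
      intros g Hg Hg'. now apply (Hdis g). }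
    rewrite abs_sum_lsum, lsum_app, <- !abs_sum_lsum in H. lra.
Qed.

(** Convergence along the net of finite subsets, since the index set may be uncountable. *)
Definition has_sum {G : Type} (a : G -> R) (L : R) : Prop :=
  forall eps, 0 < eps -> exists l0, forall l, NoDup l -> incl l0 l ->
    Rabs (lsum a l - L) < eps.

Definition tsum {G : Type} (a : G -> R) : R := epsilon (inhabits 0) (has_sum a).

Lemma NoDup_superlist {G : Type} (l : list G) : exists l', NoDup l' /\ incl l l'.
Proof.
  exists (nodup (fun a b => excluded_middle_informative (a = b)) l).
  split; [apply NoDup_nodup|]. intros g; apply nodup_In.
Qed.

Lemma has_sum_unique {G : Type} (a : G -> R) L M : has_sum a L -> has_sum a M -> L = M.
Proof.
  intros HL HM. apply cond_eq. intros eps He.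
  destruct (HL (eps / 2)) as [l1 H1]; [lra|]. destruct (HM (eps / 2)) as [l2 H2]; [lra|].
  destruct (NoDup_superlist (l1 ++ l2)) as (l & Hl & Hi).
  apply incl_app_inv in Hi as [Hi1 Hi2].
  specialize (H1 l Hl Hi1). specialize (H2 l Hl Hi2).
  apply Rabs_def2 in H1, H2. apply Rabs_def1; lra.
Qed.

Lemma has_sum_lin {G : Type} (a b : G -> R) c d L M :
  has_sum a L -> has_sum b M -> has_sum (fun g => c * a g + d * b g) (c * L + d * M).
Proof.
  intros HL HM eps He.
  set (k := Rabs c + Rabs d + 1).
  assert (Hk : 0 < k) by (unfold k; pose proof (Rabs_pos c); pose proof (Rabs_pos d); lra).
  assert (Hek : 0 < eps / k) by (now apply Rdiv_lt_0_compat).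
  destruct (HL _ Hek) as [l1 H1]. destruct (HM _ Hek) as [l2 H2].
  exists (l1 ++ l2). intros l Hl Hi. apply incl_app_inv in Hi as [Hi1 Hi2].
  specialize (H1 l Hl Hi1). specialize (H2 l Hl Hi2).
  rewrite lsum_lin.
  replace (c * lsum a l + d * lsum b l - (c * L + d * M))
    with (c * (lsum a l - L) + d * (lsum b l - M)) by ring.
  eapply Rle_lt_trans; [apply Rabs_triang|]. rewrite !Rabs_mult.
  assert (eps = k * (eps / k)) by (field; lra).
  assert (Rabs c * Rabs (lsum a l - L) <= Rabs c * (eps / k))
    by (apply Rmult_le_compat_l; [apply Rabs_pos|lra]).
  assert (Rabs d * Rabs (lsum b l - M) <= Rabs d * (eps / k))
    by (apply Rmult_le_compat_l; [apply Rabs_pos|lra]).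
  unfold k in *; lra.
Qed.

Lemma has_sum_ext {G : Type} (a b : G -> R) L :
  (forall g, a g = b g) -> has_sum a L -> has_sum b L.
Proof. intros H. now rewrite (functional_extensionality a b H). Qed.

Lemma has_sum_exists_nonneg {G : Type} (a : G -> R) :
  (forall g, 0 <= a g) -> is_l1 a -> exists L, has_sum a L.
Proof.
  intros Ha [M HM].
  assert (E : forall l, lsum a l = abs_sum a l).
  { intros l; induction l as [|g l IH]; simpl; [lra|]. now rewrite IH, Rabs_pos_eq. }
  destruct (completeness (fun s => exists l, NoDup l /\ s = lsum a l)) as [L [Lub Lleast]].
  - exists M. intros s (l & Hl & ->). rewrite E; auto.
  - exists 0, nil; split; [constructor|reflexivity].
  - exists L. intros eps He. apply NNPP; intros Hn.
    assert (Hb : L <= L - eps); [|lra].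
    apply Lleast. intros s (l0 & Hl0 & ->).
    destruct (Rle_or_lt (lsum a l0) (L - eps)) as [|Hlt]; auto.
    exfalso; apply Hn. exists l0. intros l Hl Hi.
    assert (lsum a l <= L) by (apply Lub; eauto).
    rewrite (lsum_incl_split a l0 l) in * by auto.
    pose proof (abs_sum_ge0 a (select (fun g => ~ In g l0) l)) as Hge.
    rewrite <- E in Hge. apply Rabs_def1; lra.
Qed.

Lemma has_sum_tsum {G : Type} (a : G -> R) : is_l1 a -> has_sum a (tsum a).
Proof.
  intros Ha. unfold tsum; apply epsilon_spec.
  destruct (has_sum_exists_nonneg (fun g => Rabs (a g))) as [L HL].
  - intros; apply Rabs_pos.
  - apply (is_l1_le _ a); auto. intros g; rewrite Rabs_Rabsolu; lra.
  (* [a] is the difference of the nonnegative summable families [|a| + a] and [|a|]. *)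
  - destruct (has_sum_exists_nonneg (fun g => Rabs (a g) + a g)) as [M HM].
    + intros g. pose proof (Rle_abs (- a g)). rewrite Rabs_Ropp in *; lra.
    + apply (is_l1_triang _ a a); auto. intros g.
      pose proof (Rabs_triang (Rabs (a g)) (a g)). rewrite Rabs_Rabsolu in *; lra.
    + exists (1 * M + (-1) * L).
      eapply has_sum_ext; [|apply (has_sum_lin _ _ 1 (-1) _ _ HM HL)].
      intros g; simpl; lra.
Qed.

Lemma tsum_lin {G : Type} (a b : G -> R) c d :
  is_l1 a -> is_l1 b -> tsum (fun g => c * a g + d * b g) = c * tsum a + d * tsum b.
Proof.
  intros Ha Hb.
  assert (H := has_sum_lin a b c d _ _ (has_sum_tsum a Ha) (has_sum_tsum b Hb)).
  apply (has_sum_unique _ _ _ (epsilon_spec (inhabits 0) _ (ex_intro _ _ H)) H).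
Qed.

(** Reduces estimates on infinite sums to finite ones: partial sums over lists containing [S] differ
    from the one over [S] only by terms outside [S], of total mass at most [c]. *)
Lemma tsum_approx {G : Type} (a : G -> R) S c :
  is_l1 a -> NoDup S -> mass_le (fun g => ~ In g S) a c -> Rabs (tsum a - lsum a S) <= c.
Proof.
  intros Ha HS Hc. apply le_epsilon. intros eps He.
  destruct (has_sum_tsum a Ha eps He) as [l0 H0].
  destruct (NoDup_superlist (S ++ l0)) as (l & Hl & Hi).
  apply incl_app_inv in Hi as [HiS Hi0].
  specialize (H0 l Hl Hi0). rewrite (lsum_incl_split a S l) in H0 by auto.
  set (T := select (fun g => ~ In g S) l) in *.
  assert (HT : Rabs (lsum a T) <= c).
  { eapply Rle_trans; [apply Rabs_lsum_le|]. apply Hc; [now apply NoDup_select|].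
    intros g Hg. now apply in_select in Hg. }
  replace (tsum a - lsum a S)
    with (lsum a T + - (lsum a S + lsum a T - tsum a)) by ring.
  eapply Rle_trans; [apply Rabs_triang|]. rewrite Rabs_Ropp; lra.
Qed.

Lemma tsum_bound {G : Type} (a : G -> R) c :
  mass_le (fun _ => True) a c -> Rabs (tsum a) <= c.
Proof.
  intros H.
  replace (tsum a) with (tsum a - lsum a nil) by (simpl; lra).
  apply tsum_approx; [apply is_l1_mass; eauto|constructor|].
  apply (mass_le_weaken _ (fun _ => True) a a c c); auto; intros; lra.
Qed.

(** * Functionals and the weak topology *)

Definition pairing {G : Type} (phi : G -> R) (x : l1 G) : R :=
  tsum (fun g => phi g * proj1_sig x g).

Lemma Rabs_mult_le1 (u v : R) : Rabs u <= 1 -> Rabs (u * v) <= Rabs v.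
Proof. intros H. rewrite Rabs_mult. pose proof (Rabs_pos v). nra. Qed.

Lemma is_l1_pairing {G : Type} (phi x : G -> R) :
  (forall g, Rabs (phi g) <= 1) -> is_l1 x -> is_l1 (fun g => phi g * x g).
Proof. intros Hphi Hx. apply (is_l1_le _ x); auto using Rabs_mult_le1. Qed.

Lemma pairing_minus {G : Type} (phi : G -> R) (x y : l1 G) :
  (forall g, Rabs (phi g) <= 1) ->
  pairing phi y - pairing phi x = tsum (fun g => phi g * (proj1_sig y g - proj1_sig x g)).
Proof.
  intros Hphi. unfold pairing. symmetry.
  pose proof (is_l1_pairing phi _ Hphi (proj2_sig x)).
  pose proof (is_l1_pairing phi _ Hphi (proj2_sig y)).
  rewrite <- (Rmult_1_l (tsum (fun g => phi g * proj1_sig y g))).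
  unfold Rminus at 2.
  replace (- tsum (fun g => phi g * proj1_sig x g))
    with ((-1) * tsum (fun g => phi g * proj1_sig x g)) by ring.
  rewrite <- tsum_lin by auto. f_equal. apply functional_extensionality; intros; ring.
Qed.

Lemma pairing_clf {G : Type} (phi : G -> R) :
  (forall g, Rabs (phi g) <= 1) -> cont_linear_functional (pairing phi).
Proof.
  intros Hphi. split; [split|].
  - intros x y z H. unfold pairing.
    rewrite <- (Rmult_1_l (tsum (fun g => phi g * proj1_sig x g))),
      <- (Rmult_1_l (tsum (fun g => phi g * proj1_sig y g))).
    rewrite <- tsum_lin by (apply is_l1_pairing; auto; apply proj2_sig).
    f_equal. apply functional_extensionality; intros g; rewrite H; ring.
  - intros c x z H. unfold pairing.
    pose proof (is_l1_pairing phi _ Hphi (proj2_sig x)).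
    replace (c * tsum (fun g => phi g * proj1_sig x g)) with
      (c * tsum (fun g => phi g * proj1_sig x g) + 0 * tsum (fun g => phi g * proj1_sig x g))
      by ring.
    rewrite <- tsum_lin by auto.
    f_equal. apply functional_extensionality; intros g; rewrite H; ring.
  - intros x eps He. exists eps; split; auto. intros y Hy.
    apply l1norm_lt_mass in Hy as (d & Hd & Hm).
    rewrite pairing_minus by auto. apply Rle_lt_trans with d; auto.
    apply tsum_bound.
    apply (mass_le_weaken _ _ _ _ _ _ Hm); auto using Rabs_mult_le1; lra.
Qed.

Lemma mass_le_coord {G : Type} (P : G -> Prop) x c g :
  mass_le P x c -> P g -> Rabs (x g) <= c.
Proof.
  intros H Hg. assert (abs_sum x (g :: nil) <= c) as H1.
  - apply H; [repeat constructor; simpl; tauto|]. intros h [<-|[]]; auto.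
  - simpl in H1; lra.
Qed.

Lemma coord_clf {G : Type} (g : G) :
  cont_linear_functional (fun x : l1 G => proj1_sig x g).
Proof.
  split; [split; intros; auto|].
  intros x eps He. exists eps; split; auto. intros y Hy.
  apply l1norm_lt_mass in Hy as (d & Hd & Hm).
  assert (Hg := mass_le_coord _ _ _ g Hm I); simpl in Hg; lra.
Qed.

Lemma weak_open_basic {G : Type} (fs : list (l1 G -> R)) (x : l1 G) (eps : R) :
  (forall f, In f fs -> cont_linear_functional f) ->
  weak_open (fun y => forall f, In f fs -> Rabs (f y - f x) < eps).
Proof.
  intros Hfs y Hy.
  assert (Hd : exists d, 0 < d /\ forall f, In f fs -> Rabs (f y - f x) + d <= eps).
  { clear Hfs. induction fs as [|f fs IH].
    - exists 1; split; [lra|]. intros f [].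
    - destruct IH as (d & Hd & H); [intros; apply Hy; simpl; auto|].
      pose proof (Hy f (or_introl eq_refl)).
      exists (Rmin d (eps - Rabs (f y - f x))). split; [apply Rmin_pos; lra|].
      intros h [<-|Hh].
      + pose proof (Rmin_r d (eps - Rabs (f y - f x))); lra.
      + pose proof (Rmin_l d (eps - Rabs (f y - f x))); specialize (H h Hh); lra. }
  destruct Hd as (d & Hd & H).
  exists fs, d. repeat split; auto; try (now apply Hfs).
  intros z Hz f Hf. specialize (H f Hf). specialize (Hz f Hf).
  replace (f z - f x) with ((f z - f y) + (f y - f x)) by ring.
  eapply Rle_lt_trans; [apply Rabs_triang|]. lra.
Qed.

Lemma weak_regular (G : Type) : regular (@weak_open G).
Proof.
  intros x F HF Hx.
  destruct (HF x Hx) as (fs & eps & Hfs & He & Hd).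
  (* The first set keeps all deviations below [eps / 2], the second forces one above it, and a point
     of [F] has one of at least [eps]. *)
  exists (fun y => forall f, In f fs -> Rabs (f y - f x) < eps / 2).
  exists (fun y => exists f, In f fs /\ eps / 2 < Rabs (f y - f x)).
  split; [now apply weak_open_basic|]. split; [|split; [|split]].
  - intros y (f & Hf & Hy).
    exists (f :: nil), (Rabs (f y - f x) - eps / 2).
    split; [intros h [<-|[]]; auto|]. split; [lra|].
    intros z Hz. exists f; split; auto. specialize (Hz f (or_introl eq_refl)).
    pose proof (Rabs_triang (f z - f x) (- (f z - f y))) as T.
    replace (f z - f x + - (f z - f y)) with (f y - f x) in T by ring.
    rewrite Rabs_Ropp in T; lra.
  - intros f _. unfold Rminus. rewrite Rplus_opp_r, Rabs_R0. lra.
  - intros y Hy. apply NNPP; intros Hn. apply (Hd y); auto.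
    intros f Hf. destruct (Rlt_or_le (Rabs (f y - f x)) eps); auto.
    exfalso; apply Hn; exists f; split; auto; lra.
  - intros y Hy (f & Hf & Hlt). specialize (Hy f Hf); lra.
Qed.

Lemma weak_open_norm_ball {G : Type} (U : l1 G -> Prop) (x : l1 G) :
  weak_open U -> U x -> exists d, 0 < d /\
    forall y : l1 G, l1norm_lt (fun g => proj1_sig y g - proj1_sig x g) d -> U y.
Proof.
  intros HU Hx. destruct (HU x Hx) as (fs & eps & Hfs & He & H).
  enough (exists d, 0 < d /\ forall y : l1 G,
    l1norm_lt (fun g => proj1_sig y g - proj1_sig x g) d ->
    forall f, In f fs -> Rabs (f y - f x) < eps) as (d & Hd & Hy) by (exists d; auto).
  clear H. induction fs as [|f fs IH].
  - exists 1; split; [lra|]. intros y _ f [].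
  - destruct IH as (d & Hd & H); [intros; apply Hfs; simpl; auto|].
    destruct (proj2 (Hfs f (or_introl eq_refl)) x eps He) as (d' & Hd' & H').
    exists (Rmin d d'); split; [now apply Rmin_pos|].
    intros y (e & Hlt & Hm) h [<-|Hh].
    + apply H'. exists e; split; auto. pose proof (Rmin_r d d'); lra.
    + apply H; auto. exists e; split; auto. pose proof (Rmin_l d d'); lra.
Qed.

(** * Aleph-space implies small cardinality *)

(** Closed with [Defined] so that [simpl] can compute its coordinates. *)
Definition l1_unit {G : Type} (g : G) : l1 G.
Proof.
  exists (fun h => if excluded_middle_informative (h = g) then 1 else 0).
  apply is_l1_mass. exists (INR (length (g :: nil)) * 1 + INR (length (@nil G)) * 0).
  apply (mass_le_split (fun h => h = g)).
  - apply mass_le_finite; [lra|simpl; intuition|].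
    intros h _. destruct (excluded_middle_informative _); rewrite ?Rabs_R1, ?Rabs_R0; lra.
  - apply mass_le_zero; [simpl; lra|]. intros h [_ Hh].
    now destruct (excluded_middle_informative _).
Defined.

Lemma clf_minus {G : Type} (f : l1 G -> R) (x y z : l1 G) :
  cont_linear_functional f ->
  (forall g, proj1_sig z g = proj1_sig x g - proj1_sig y g) -> f z = f x - f y.
Proof.
  intros [[Hadd _] _] H.
  assert (f x = f z + f y); [|lra]. apply Hadd. intros g; rewrite H; lra.
Qed.

(** The Dedekind cut of [r]: [n] codes a triple [(c, (a, b))], and the bit compares the fraction
    [(a - b) / c] with [r] after clearing the denominator. *)
Definition cut_code (r : R) (n : nat) : bool :=
  let (c, ab) := of_nat n in let (a, b) := of_nat ab in
  if Rlt_dec (INR a - INR b) (INR c * r) then true else false.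

Lemma cut_code_inj_lt r s : cut_code r = cut_code s -> ~ r < s.
Proof.
  intros H Hlt.
  (* With [c (s - r) > 1] the least integer above [c r] lies strictly below [c s]; the bit for this
     integer over [c] tells [r] from [s]. *)
  destruct (INR_unbounded (/ (s - r))) as [c Hc].
  assert (H0 : 0 < / (s - r)) by (apply Rinv_0_lt_compat; lra).
  assert (H1 : 1 < INR c * (s - r)).
  { apply (Rmult_lt_compat_r (s - r)) in Hc; [|lra]. rewrite Rinv_l in Hc; lra. }
  destruct (archimed (INR c * r)) as [Hu1 Hu2].
  set (k := up (INR c * r)) in *.
  assert (Hk : IZR k = INR (Z.to_nat k) - INR (Z.to_nat (- k))).
  { rewrite !INR_IZR_INZ, <- minus_IZR. f_equal. lia. }
  assert (E := equal_f H (to_nat (c, to_nat (Z.to_nat k, Z.to_nat (- k))))).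
  unfold cut_code in E. rewrite !cancel_of_to in E. rewrite <- Hk in E.
  destruct (Rlt_dec (IZR k) (INR c * r)); [lra|].
  destruct (Rlt_dec (IZR k) (INR c * s)); [discriminate|lra].
Qed.

Lemma cut_code_inj r s : cut_code r = cut_code s -> r = s.
Proof.
  intros H. pose proof (cut_code_inj_lt r s H). pose proof (cut_code_inj_lt s r (eq_sym H)). lra.
Qed.

Lemma sequences_le_continuum : card_le_continuum (nat -> R).
Proof.
  exists (fun u n => let (j, k) := of_nat n in cut_code (u j) k).
  intros u v H. apply functional_extensionality; intros j.
  apply cut_code_inj, functional_extensionality; intros k.
  assert (E := equal_f H (to_nat (j, k))). cbv beta in E. now rewrite cancel_of_to in E.
Qed.

Lemma compact_singleton {X : Type} (open : (X -> Prop) -> Prop) (x : X) :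
  compact open (fun y => y = x).
Proof.
  intros C HC H. destruct (H x eq_refl) as (U & HU & Ux).
  exists (U :: nil); split; [intros V [<-|[]]; auto|].
  intros y ->. exists U; simpl; auto.
Qed.

Lemma weak_open_and {G : Type} (U V : l1 G -> Prop) :
  weak_open U -> weak_open V -> weak_open (fun x => U x /\ V x).
Proof.
  intros HU HV x [Ux Vx].
  destruct (HU x Ux) as (fs & e & Hfs & He & HfU).
  destruct (HV x Vx) as (gs & d & Hgs & Hd & HgV).
  exists (fs ++ gs), (Rmin e d).
  split; [intros f Hf; apply in_app_or in Hf as [|]; auto|].
  split; [now apply Rmin_pos|]. intros y Hy.
  split; [apply HfU|apply HgV]; intros f Hf.
  - apply Rlt_le_trans with (Rmin e d); [|apply Rmin_l]. apply Hy, in_or_app; auto.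
  - apply Rlt_le_trans with (Rmin e d); [|apply Rmin_r]. apply Hy, in_or_app; auto.
Qed.

(** Only finitely many members of [F] meet some neighbourhood of [x]; it is intersected with a
    separating neighbourhood for each of those that have one. Applied at 0 to each of the countably
    many families, this gives countably many neighbourhoods with intersection {0}. *)
Lemma locally_finite_separation {G : Type} (F : (l1 G -> Prop) -> Prop) (x : l1 G) :
  locally_finite weak_open F ->
  exists V, weak_open V /\ V x /\
    forall A, F A -> (exists W, weak_open W /\ W x /\ forall y, W y -> ~ A y) ->
      forall y, V y -> ~ A y.
Proof.
  intros HF. destruct (HF x) as (V & HV & Vx & l & Hl).
  enough (exists V', weak_open V' /\ V' x /\ forall A, In A l ->
    (exists W, weak_open W /\ W x /\ forall y, W y -> ~ A y) -> forall y, V' y -> ~ A y)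
    as (V' & HV' & V'x & H).
  { exists (fun y => V y /\ V' y). repeat split; auto using weak_open_and.
    intros A FA HA y [Vy V'y] Ay. apply (H A) with y; auto. apply Hl; eauto. }
  clear Hl. induction l as [|B l IH].
  - exists V; repeat split; auto.
  - destruct IH as (V' & HV' & V'x & H).
    destruct (classic (exists W, weak_open W /\ W x /\ forall y, W y -> ~ B y))
      as [(W & HW & Wx & HB)|HB].
    + exists (fun y => V' y /\ W y). repeat split; auto using weak_open_and.
      intros A [<-|HA] HsA y [Hy1 Hy2]; eauto.
    + exists V'. repeat split; auto. intros A [<-|HA]; [tauto|auto].
Qed.

(** The strips of half-width [e / 2] around [x] and [y] in the coordinate [g] are disjoint. As the
    singleton of [x] is compact, some network member through [x] lies in the first strip. *)
Lemma network_separates {G : Type} (N : (l1 G -> Prop) -> Prop) (x y : l1 G) g :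
  k_network weak_open N -> proj1_sig x g <> proj1_sig y g ->
  exists A, N A /\ A x /\ exists W, weak_open W /\ W y /\ forall z, W z -> ~ A z.
Proof.
  intros HN Hg.
  set (e := Rabs (proj1_sig x g - proj1_sig y g)).
  assert (He : 0 < e) by (apply Rabs_pos_lt; lra).
  set (B := fun w z : l1 G => forall f, In f ((fun v : l1 G => proj1_sig v g) :: nil) ->
     Rabs (f z - f w) < e / 2).
  assert (HB : forall w, weak_open (B w)).
  { intros w. apply weak_open_basic. intros f [<-|[]]. apply coord_clf. }
  assert (Bw : forall w, B w w).
  { intros w f _. unfold Rminus. rewrite Rplus_opp_r, Rabs_R0. lra. }
  destruct (HN (fun z => z = x) (B x)) as (l & Hl & Hx & HlB).
  - apply compact_singleton.
  - apply HB.
  - intros z ->. apply Bw.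
  - destruct (Hx x eq_refl) as (A & HA & Ax).
    exists A; repeat split; auto. exists (B y); repeat split; auto.
    intros z Bz Az.
    assert (Bxz : B x z) by (apply HlB; exists A; auto).
    specialize (Bz _ (or_introl eq_refl)). specialize (Bxz _ (or_introl eq_refl)).
    simpl in *. unfold e in *.
    pose proof (Rabs_triang (proj1_sig z g - proj1_sig y g)
                  (- (proj1_sig z g - proj1_sig x g))) as T.
    rewrite Rabs_Ropp in T.
    replace (proj1_sig z g - proj1_sig y g + - (proj1_sig z g - proj1_sig x g))
      with (proj1_sig x g - proj1_sig y g) in T by ring. lra.
Qed.

Lemma card_le_continuum_inj (G H : Type) (f : G -> H) :
  (forall a b, f a = f b -> a = b) -> card_le_continuum H -> card_le_continuum G.
Proof. intros Hf [i Hi]. exists (fun a => i (f a)). auto. Qed.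

Lemma aleph_space_card {G : Type} : aleph_space (@weak_open G) -> card_le_continuum G.
Proof.
  intros (_ & N & (Ns & Hlf & HNs) & HN).
  assert (Hz : is_l1 (fun _ : G => 0)).
  { exists 0. intros l _. induction l; simpl; rewrite ?Rabs_R0; lra. }
  set (zero := exist _ _ Hz : l1 G).
  (* For each [n], finitely many functionals and a radius describe a neighbourhood of 0 that avoids
     every member of [Ns n] separable from 0. *)
  destruct (choice_function (fun n (p : list (l1 G -> R) * R) =>
    (forall f, In f (fst p) -> cont_linear_functional f) /\ 0 < snd p /\
    forall A, Ns n A -> (exists W, weak_open W /\ W zero /\ forall y, W y -> ~ A y) ->
      forall y, (forall f, In f (fst p) -> Rabs (f y - f zero) < snd p) -> ~ A y))
    as [p Hp].
  { intros n. destruct (locally_finite_separation _ zero (Hlf n)) as (V & HV & V0 & H).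
    destruct (HV zero V0) as (fs & eps & Hfs & He & HfV).
    exists (fs, eps); simpl. split; [exact Hfs|]. split; [exact He|].
    intros A NA HA y Hy. apply (H A); auto. }
  (* Send [g] to the values of all chosen functionals at its unit vector; indices beyond the end of
     a list read the zero function. *)
  apply (card_le_continuum_inj _ _ (fun (g : G) (k : nat) =>
    let (n, j) := of_nat k in
    nth j (fst (p n)) (fun _ : l1 G => 0) (l1_unit g))); [|apply sequences_le_continuum].
  intros a b Hab. apply NNPP; intros Hne.
  set (z := exist _ _ (is_l1_minus _ _ (proj2_sig (l1_unit a)) (proj2_sig (l1_unit b))) : l1 G).
  destruct (network_separates N z zero a HN) as (A & NA & Az & HA).
  { simpl. destruct (excluded_middle_informative (a = a)); [|tauto].
    destruct (excluded_middle_informative (a = b)); [tauto|lra]. }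
  apply HNs in NA as [n NA]. destruct (Hp n) as (Hfs & He & H).
  (* All chosen functionals agree on the two unit vectors, hence vanish on [z]; so [z] lies in the
     neighbourhood that avoids [A], although [A] contains it. *)
  apply (H A NA HA z); auto. intros f Hf.
  destruct (In_nth _ _ (fun _ : l1 G => 0) Hf) as (j & Hj & Hnth).
  assert (E := equal_f Hab (to_nat (n, j))). cbv beta in E.
  rewrite cancel_of_to, Hnth in E.
  rewrite (clf_minus f (l1_unit a) (l1_unit b) z) by auto.
  rewrite (clf_minus f zero zero zero) by (auto; intros; simpl; lra).
  replace (f (l1_unit a) - f (l1_unit b) - (f zero - f zero)) with 0 by lra.
  now rewrite Rabs_R0.
Qed.

(** * Weakly compact sets *)

(** Compactness packaged for reuse: the data of finitely many neighbourhoods are merged by [join],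
    starting from [bot]. The instances are numbers under [Nat.max] and lists under concatenation. *)
Lemma compact_local_to_global {X D : Type} (open : (X -> Prop) -> Prop) (K : X -> Prop)
  (join : D -> D -> D) (bot : D) (Q : D -> X -> Prop) :
  compact open K ->
  (forall d d' x, Q d x -> Q (join d d') x) -> (forall d d' x, Q d' x -> Q (join d d') x) ->
  (forall x, K x -> exists W d, open W /\ W x /\ forall y, K y -> W y -> Q d y) ->
  exists d, forall x, K x -> Q d x.
Proof.
  intros HK Hl Hr Hloc.
  destruct (HK (fun W => open W /\ exists d, forall y, K y -> W y -> Q d y)) as (l & Hin & Hc).
  - tauto.
  - intros x Kx. destruct (Hloc x Kx) as (W & d & HW & Wx & H).
    exists W; repeat split; eauto.
  - enough (exists d, forall x, K x -> union_list l x -> Q d x) as [d H] by (exists d; auto).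
    clear Hc. induction l as [|W l IH].
    + exists bot. intros x _ (A & [] & _).
    + destruct IH as [d Hd]; [intros; apply Hin; simpl; auto|].
      destruct (Hin W (or_introl eq_refl)) as [_ [d' Hd']].
      exists (join d' d). intros x Kx (A & [<-|HA] & Ax); auto.
      apply Hr, Hd; auto. exists A; auto.
Qed.

(** Otherwise each point has a neighbourhood that the sequence avoids from some index on; the
    largest [N] of finitely many such indices would put [u N] outside [K]. *)
Lemma compact_cluster_point {X : Type} (open : (X -> Prop) -> Prop) (K : X -> Prop)
  (u : nat -> X) :
  compact open K -> (forall n, K (u n)) ->
  exists x, K x /\ forall W N, open W -> W x -> exists n, (N <= n)%nat /\ W (u n).
Proof.
  intros HK Ku. apply NNPP; intros Hn.
  destruct (compact_local_to_global open K Nat.max 0%nat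
    (fun N x => forall n, (N <= n)%nat -> u n <> x) HK) as [N HN].
  - intros d d' x H n Hle; apply H; lia.
  - intros d d' x H n Hle; apply H; lia.
  - intros x Kx. apply NNPP; intros Hx. apply Hn. exists x; split; auto.
    intros W N HW Wx. apply NNPP; intros Hno. apply Hx.
    exists W, N; repeat split; auto. intros y _ Wy n Hle <-. apply Hno; eauto.
  - exact (HN (u N) (Ku N) N (le_n N) eq_refl).
Qed.

Definition uniform_tails {G : Type} (K : l1 G -> Prop) : Prop :=
  forall eps, 0 < eps -> exists S, forall x, K x ->
    mass_le (fun g => ~ In g S) (proj1_sig x) eps.

Lemma not_mass_le {G : Type} (P : G -> Prop) x c :
  ~ mass_le P x c -> exists l, NoDup l /\ (forall g, In g l -> P g) /\ c < abs_sum x l.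
Proof.
  intros H. apply NNPP; intros Hn. apply H. intros l Hl HP.
  apply Rnot_lt_le; intros Hlt. apply Hn; eauto.
Qed.

(** Disjointness of the blocks lets one [phi] follow the sign of [z n] on [b n] for all [n] at once,
    so that it recovers the full mass of [z n] on that block. *)
Lemma sign_pattern {G : Type} (b : nat -> list G) (z : nat -> G -> R) :
  (forall m n g, In g (b m) -> In g (b n) -> m = n) ->
  exists phi : G -> R, (forall g, Rabs (phi g) <= 1) /\
    (forall n g, In g (b n) -> phi g * z n g = Rabs (z n g)) /\
    (forall g, (forall n, ~ In g (b n)) -> phi g = 0).
Proof.
  intros Hdis.
  destruct (choice_function (fun g r => Rabs r <= 1 /\
    (forall n, In g (b n) -> r * z n g = Rabs (z n g)) /\
    ((forall n, ~ In g (b n)) -> r = 0))) as [phi H].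
  - intros g. destruct (classic (exists n, In g (b n))) as [[n Hn]|Hn].
    + destruct (Rcase_abs (z n g)) as [Hneg|Hpos].
      * exists (-1). split; [rewrite Rabs_left; lra|]. split; [|intros H; now elim (H n)].
        intros m Hm. rewrite <- (Hdis n m g Hn Hm), Rabs_left; lra.
      * exists 1. split; [rewrite Rabs_R1; lra|]. split; [|intros H; now elim (H n)].
        intros m Hm. rewrite <- (Hdis n m g Hn Hm), Rabs_right; lra.
    + exists 0. split; [rewrite Rabs_R0; lra|]. split; [|auto].
      intros n Hin. elim Hn; eauto.
  - exists phi. repeat split; intros; apply H; auto.
Qed.

Definition l1_sub {G : Type} (y x : l1 G) : G -> R := fun g => proj1_sig y g - proj1_sig x g.

Lemma weak_open_coords {G : Type} (S : list G) (x : l1 G) e :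
  weak_open (fun y => forall g, In g S -> Rabs (l1_sub y x g) < e).
Proof.
  set (fs := map (fun g (y : l1 G) => proj1_sig y g) S).
  assert (E : forall y, (forall f, In f fs -> Rabs (f y - f x) < e) <->
                        (forall g, In g S -> Rabs (l1_sub y x g) < e)).
  { intros y; unfold fs; split.
    - intros Hy g Hg. apply (Hy (fun y => proj1_sig y g)), in_map_iff; eauto.
    - intros Hy f Hf. apply in_map_iff in Hf as (g & <- & Hg). now apply Hy. }
  intros y Hy. destruct (weak_open_basic fs x e) with (x := y) as (gs & d & Hgs & Hd & HU).
  - intros f Hf. apply in_map_iff in Hf as (g & <- & _). apply coord_clf.
  - now apply E.
  - exists gs, d; split; [exact Hgs|]. split; [exact Hd|]. intros w Hw. now apply E, HU.
Qed.

Lemma Rabs_sub_le u v : Rabs (u - v) <= Rabs u + Rabs v.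
Proof. unfold Rminus. rewrite <- (Rabs_Ropp v). apply Rabs_triang. Qed.

Lemma l1_sub_self {G : Type} (x : l1 G) g e : 0 < e -> Rabs (l1_sub x x g) < e.
Proof. intros. unfold l1_sub, Rminus. now rewrite Rplus_opp_r, Rabs_R0. Qed.

(* One hump: [y] nearly agrees with [x] on [S], while it carries mass [> eps] on a block [l]
   outside [S]; [S'] then captures [y] up to [eps / 8]. *)
Definition hump {G : Type} (K : l1 G -> Prop) (x : l1 G) (eps : R) (S : list G) (n : nat)
  (y : l1 G) (l S' : list G) : Prop :=
  K y /\ (forall g, In g S -> Rabs (l1_sub y x g) < / (INR n + 1)) /\
  mass_le (fun g => In g S) (l1_sub y x) (eps / 8) /\
  NoDup l /\ (forall g, In g l -> ~ In g S) /\ eps < abs_sum (proj1_sig y) l /\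
  incl S S' /\ incl l S' /\ mass_le (fun g => ~ In g S') (proj1_sig y) (eps / 8).

Lemma hump_exists {G : Type} (K : l1 G -> Prop) (x : l1 G) (eps : R) :
  0 < eps ->
  (forall W S, weak_open W -> W x ->
     exists y, K y /\ W y /\ ~ mass_le (fun g => ~ In g S) (proj1_sig y) eps) ->
  forall S n, exists y l S', hump K x eps S n y l S'.
Proof.
  intros He Hbad S n.
  (* Errors of [eps / 8 / k] at the coordinates in [S] add up to at most [eps / 8]; the [+ 1] covers
     an empty [S]. *)
  set (k := INR (length S) + 1).
  assert (Hk : 0 < k) by (unfold k; pose proof (pos_INR (length S)); lra).
  assert (Hn : 0 < INR n + 1) by (pose proof (pos_INR n); lra).
  assert (Hek : 0 < eps / 8 / k) by (apply Rdiv_lt_0_compat; lra).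
  set (e := Rmin (/ (INR n + 1)) (eps / 8 / k)).
  assert (He0 : 0 < e) by (apply Rmin_pos; auto; now apply Rinv_0_lt_compat).
  destruct (Hbad _ S (weak_open_coords S x e)) as (y & Ky & Wy & Hy).
  { intros; now apply l1_sub_self. }
  apply not_mass_le in Hy as (l & Hl & HlS & Hlt).
  destruct (small_tail (proj1_sig y) (eps / 8) (proj2_sig y)) as (T & _ & HT); [lra|].
  exists y, l, (S ++ l ++ T). repeat split; auto.
  - intros g Hg. apply Rlt_le_trans with e; auto. apply Rmin_l.
  - apply (mass_le_weaken _ (fun g => In g S) _ (l1_sub y x) _
      (INR (length S) * (eps / 8 / k))); auto; try (intros; lra).
    + apply mass_le_finite; auto; [lra|].
      intros g Hg. apply Rlt_le, Rlt_le_trans with e; auto. apply Rmin_r.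
    + apply Rle_trans with (k * (eps / 8 / k)); [unfold k in *; nra|].
      right; field; lra.
  - apply incl_appl, incl_refl.
  - apply incl_appr, incl_appl, incl_refl.
  - apply (mass_le_weaken _ _ _ _ _ _ HT); try (intros; lra).
    intros g Hg Hin; apply Hg. rewrite !in_app_iff; auto.
Qed.

(** Otherwise humps taken from [K] glide off along disjoint blocks, and a single sign functional has
    values at them exceeding its value at some [x] by at least [eps / 2]. A weak cluster point of
    the humps agrees with [x] wherever this functional is supported, which is absurd. *)
Lemma weakly_compact_uniform_tails {G : Type} (K : l1 G -> Prop) :
  compact weak_open K -> uniform_tails K.
Proof.
  intros HK eps He. apply NNPP; intros Hno.
  (* If there were no such point, every point of [K] would have a neighbourhood with a common tail
     set, and compactness would join these into one. *)
  assert (exists x, K x /\ forall W S, weak_open W -> W x ->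
     exists y, K y /\ W y /\ ~ mass_le (fun g => ~ In g S) (proj1_sig y) eps)
    as (x & Kx & Hbad).
  { apply NNPP; intros Hn. apply Hno.
    apply (compact_local_to_global weak_open K (@app G) nil
      (fun S x => mass_le (fun g => ~ In g S) (proj1_sig x) eps) HK).
    - intros S S' x H. apply (mass_le_weaken _ _ _ _ _ _ H); try (intros; lra).
      intros g Hg Hin; apply Hg, in_or_app; auto.
    - intros S S' x H. apply (mass_le_weaken _ _ _ _ _ _ H); try (intros; lra).
      intros g Hg Hin; apply Hg, in_or_app; auto.
    - intros x Kx. apply NNPP; intros Hx. apply Hn. exists x; split; auto.
      intros W S HW Wx. apply NNPP; intros Hy. apply Hx. exists W, S; repeat split; auto.
      intros y Ky Wy. apply NNPP; intros Hm. apply Hy; eauto. }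
  destruct (choice_function (fun (p : list G * nat) (q : l1 G * list G * list G) =>
    hump K x eps (fst p) (snd p) (fst (fst q)) (snd (fst q)) (snd q))) as [step Hstep].
  { intros [S n]. destruct (hump_exists K x eps He Hbad S n) as (y & l & S' & H).
    now exists (y, l, S'). }
  destruct (small_tail (proj1_sig x) (eps / 8) (proj2_sig x)) as (S0 & _ & HS0); [lra|].
  (* The sets [Sn n] grow: hump [u n] is chosen after [Sn n] and is then captured, up to mass
     [eps / 8], by [Sn (S n)]. *)
  set (Sn := fix Sn n := match n with O => S0 | S n => snd (step (Sn n, n)) end).
  set (u := fun n => fst (fst (step (Sn n, n)))).
  set (b := fun n => snd (fst (step (Sn n, n)))).
  assert (H : forall n, hump K x eps (Sn n) n (u n) (b n) (Sn (S n)))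
    by (intros n; apply (Hstep (Sn n, n))).
  assert (Hmono : forall m n, (m <= n)%nat -> incl (Sn m) (Sn n)).
  { induction 1; [apply incl_refl|]. eapply incl_tran; [eassumption|]. apply H. }
  assert (Hb : forall m n g, (m < n)%nat -> In g (b m) -> In g (Sn n)).
  { intros m n g Hmn Hg. apply (Hmono (S m) n Hmn). now apply H. }
  assert (Hout : forall n g, In g (b n) -> ~ In g (Sn n)).
  { intros n. destruct (H n) as (_ & _ & _ & _ & Hn & _). exact Hn. }
  assert (Hdis : forall m n g, In g (b m) -> In g (b n) -> m = n).
  { intros m n g Hm Hn. destruct (lt_eq_lt_dec m n) as [[Hlt|Heq]|Hlt]; auto; exfalso.
    - apply (Hout n g Hn), (Hb m); auto.
    - apply (Hout m g Hm), (Hb n); auto. }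
  destruct (sign_pattern b (fun n => l1_sub (u n) x) Hdis) as (phi & Hphi & Hphib & Hphi0).
  (* The block contributes at least [7/8 eps], since [x] has mass at most [eps / 8] there. Off the
     block the loss is at most [eps / 8] on [Sn n], nothing on the rest of [Sn (S n)], and [2/8 eps]
     beyond it. *)
  assert (Hgap : forall n, eps / 2 <= pairing phi (u n) - pairing phi x).
  { intros n. destruct (H n) as (_ & _ & Hnear & Hnd & _ & Hmass & _ & _ & Htail).
    rewrite pairing_minus by auto. fold (l1_sub (u n) x).
    assert (Hl1 : is_l1 (l1_sub (u n) x)) by (apply is_l1_minus; apply proj2_sig).
    assert (Hx : forall k, mass_le (fun g => ~ In g (Sn k)) (proj1_sig x) (eps / 8)).
    { intros k. apply (mass_le_weaken _ _ _ _ _ _ HS0); try (intros; lra).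
      intros g Hg Hin. apply Hg, (Hmono 0%nat k); auto; lia. }
    assert (Hap := tsum_approx (fun g => phi g * l1_sub (u n) x g) (b n)
      (eps / 8 + (0 + (eps / 8 + eps / 8)))).
    assert (Hblock : lsum (fun g => phi g * l1_sub (u n) x g) (b n)
                     = abs_sum (l1_sub (u n) x) (b n)).
    { rewrite abs_sum_lsum. apply Rle_antisym; apply lsum_le; intros g Hg;
        rewrite (Hphib n g Hg); lra. }
    assert (Hbig : abs_sum (proj1_sig (u n)) (b n)
                   <= abs_sum (l1_sub (u n) x) (b n) + abs_sum (proj1_sig x) (b n)).
    { apply abs_sum_triang. intros g _. unfold l1_sub.
      replace (proj1_sig (u n) g) with
        ((proj1_sig (u n) g - proj1_sig x g) + proj1_sig x g) at 1 by ring.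
      apply Rabs_triang. }
    assert (Hsmall : abs_sum (proj1_sig x) (b n) <= eps / 8) by (apply (Hx n); auto).
    rewrite Hblock in Hap.
    enough (Hoff : mass_le (fun g => ~ In g (b n)) (fun g => phi g * l1_sub (u n) x g)
                     (eps / 8 + (0 + (eps / 8 + eps / 8)))).
    { specialize (Hap (is_l1_pairing _ _ Hphi Hl1) Hnd Hoff).
      revert Hap. unfold Rabs. destruct (Rcase_abs _); unfold l1_sub in *; lra. }
    apply (mass_le_split (fun g => In g (Sn n))).
    - apply (mass_le_weaken _ _ _ _ _ _ Hnear); try (intros; lra); [tauto|].
      auto using Rabs_mult_le1.
    - apply (mass_le_split (fun g => In g (Sn (S n)))).
      (* No block contains such a [g]: earlier blocks lie in [Sn n] and later ones avoid
         [Sn (S n)]. *)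
      + apply mass_le_zero; [lra|]. intros g [[Hgb HgS] HgS'].
        rewrite Hphi0; [ring|].
        intros k Hk. destruct (lt_eq_lt_dec k n) as [[Hlt|Heq]|Hlt].
        * apply HgS, (Hb k); auto.
        * subst; auto.
        * apply (Hout k g Hk), (Hmono (S n) k); auto.
      + apply (mass_le_triang _ _ (proj1_sig (u n)) (proj1_sig x)).
        * apply (mass_le_weaken _ _ _ _ _ _ Htail); try (intros; lra); tauto.
        * apply (mass_le_weaken _ _ _ _ _ _ (Hx (S n))); try (intros; lra); tauto.
        * intros g _. eapply Rle_trans; [apply Rabs_mult_le1; auto|]. apply Rabs_sub_le. }
  destruct (compact_cluster_point weak_open K u HK) as (x' & _ & Hclus).
  { intros n; apply H. }
  assert (Heq : forall g, phi g * proj1_sig x' g = phi g * proj1_sig x g).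
  { intros g. destruct (classic (exists n, In g (b n))) as [[n Hn]|Hn].
    (* A point [g] of block [n] belongs to [Sn m] for all [m > n], so [u m] tends to [x] at [g]; it
       also comes arbitrarily close to [x'] there for large [m]. *)
    - f_equal. apply cond_eq. intros e He'.
      destruct (INR_unbounded (/ (e / 2))) as [N HN].
      destruct (Hclus _ (Nat.max N (S n)) (weak_open_coords (g :: nil) x' (e / 2)))
        as (m & Hm & Hum).
      { intros; apply l1_sub_self; lra. }
      specialize (Hum g (or_introl eq_refl)).
      assert (Hum' : Rabs (l1_sub (u m) x g) < / (INR m + 1)).
      { apply (H m). apply (Hb n); auto; lia. }
      assert (/ (INR m + 1) < e / 2).
      { rewrite <- (Rinv_inv (e / 2)). apply Rinv_lt_contravar.
        - apply Rmult_lt_0_compat; [apply Rinv_0_lt_compat; lra|].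
          pose proof (pos_INR m); lra.
        - assert (INR N <= INR m) by (apply le_INR; lia). lra. }
      unfold l1_sub in *.
      replace (proj1_sig x' g - proj1_sig x g)
        with ((proj1_sig (u m) g - proj1_sig x g) - (proj1_sig (u m) g - proj1_sig x' g))
        by ring.
      eapply Rle_lt_trans; [apply Rabs_sub_le|]. lra.
    - rewrite Hphi0; [ring|]. intros n Hn'; apply Hn; eauto. }
  (* Some [u m] is within [eps / 2] of [x'] under [phi], whose values at [x'] and [x] coincide; this
     contradicts the gap. *)
  destruct (Hclus _ 0%nat (weak_open_basic (pairing phi :: nil) x' (eps / 2)
    ltac:(intros f [<-|[]]; now apply pairing_clf))) as (m & _ & Hm).
  { intros f _. unfold Rminus. rewrite Rplus_opp_r, Rabs_R0. lra. }
  specialize (Hm _ (or_introl eq_refl)). specialize (Hgap m).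
  replace (pairing phi x') with (pairing phi x) in Hm.
  - pose proof (Rle_abs (pairing phi (u m) - pairing phi x)). lra.
  - unfold pairing. f_equal. apply functional_extensionality; intros; auto.
Qed.

(* With uniform tails, the weak and the norm topology agree on [K]. *)
Lemma weakly_compact_norm_cover {G : Type} (K : l1 G -> Prop) (C : (l1 G -> Prop) -> Prop) :
  compact weak_open K ->
  (forall x, K x -> exists A rho, C A /\ 0 < rho /\
     forall y, mass_le (fun _ => True) (l1_sub y x) rho -> A y) ->
  exists l, (forall A, In A l -> C A) /\ subset K (union_list l).
Proof.
  intros HK Hcov.
  destruct (compact_local_to_global weak_open K (@app _) nil
    (fun l x => exists A, In A l /\ C A /\ A x) HK) as [l H].
  - intros d d' x (A & HA & Ax). exists A; split; auto. apply in_or_app; auto.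
  - intros d d' x (A & HA & Ax). exists A; split; auto. apply in_or_app; auto.
  - intros x Kx. destruct (Hcov x Kx) as (A & rho & CA & Hrho & HA).
    (* The budget is [rho / 2] on [S], and [rho / 4] for each of the tails of [x] and [y]. *)
    destruct (weakly_compact_uniform_tails K HK (rho / 4)) as [S HS]; [lra|].
    set (k := INR (length S) + 1).
    assert (Hk : 0 < k) by (unfold k; pose proof (pos_INR (length S)); lra).
    assert (Hrk : 0 < rho / 2 / k) by (apply Rdiv_lt_0_compat; lra).
    exists (fun y => forall g, In g S -> Rabs (l1_sub y x g) < rho / 2 / k), (A :: nil).
    split; [apply weak_open_coords|]. split; [intros; now apply l1_sub_self|].
    intros y Ky Hy. exists A; split; [simpl; auto|]. split; auto. apply HA.
    apply (mass_le_weaken _ (fun _ => True) _ (l1_sub y x) _ 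
      (INR (length S) * (rho / 2 / k) + (rho / 4 + rho / 4))); auto; try (intros; lra).
    + apply (mass_le_split (fun g => In g S)).
      * apply mass_le_finite; [lra|tauto|]. intros g [_ Hg]. apply Rlt_le; auto.
      * apply (mass_le_triang _ _ (proj1_sig y) (proj1_sig x)).
        -- apply (mass_le_weaken _ _ _ _ _ _ (HS y Ky)); try (intros; lra); tauto.
        -- apply (mass_le_weaken _ _ _ _ _ _ (HS x Kx)); try (intros; lra); tauto.
        -- intros; apply Rabs_sub_le.
    + assert (k * (rho / 2 / k) = rho / 2) by (field; lra). unfold k in *; nra.
  (* The merged list is only known to have a suitable entry of [C] at each point of [K], so its
     other entries are filtered out. *)
  - exists (select C l). split.
    + intros A HA. now apply in_select in HA.
    + intros x Kx. destruct (H x Kx) as (A & HA & CA & Ax).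
      exists A; split; auto. now apply in_select.
Qed.

(** * The network *)

Definition prefix {G : Type} (i : G -> nat -> bool) (m : nat) (g : G) : list bool :=
  map (i g) (seq 0 m).

(* A center [c] is the finitely supported vector with value [k / t] at [g] for each
   [(g, k)] in [c]. *)
Definition cell {G : Type} (i : G -> nat -> bool) (m t r : nat) (c : list (G * Z))
  (y : l1 G) : Prop :=
  (forall g k, In (g, k) c -> Rabs (proj1_sig y g - IZR k / INR t) <= 2 / INR t) /\
  (forall g, In g (map fst c) ->
     mass_le (fun h => prefix i m h = prefix i m g /\ h <> g) (proj1_sig y) (1 / INR t)) /\
  mass_le (fun h => ~ In h (map fst c)) (proj1_sig y) (1 / INR r).

(** The inequality with [t] makes errors of order [1 / t] on the support sum to order [1 / r], and
    bounds the length of [c]. The bound 6 lifts the values at support points above all tolerances of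
    a cell, so that cylinder sums detect them. *)
Definition admissible {G : Type} (t r : nat) (c : list (G * Z)) : Prop :=
  (0 < r)%nat /\ (r * (1 + length c) <= t)%nat /\ (forall g k, In (g, k) c -> (6 <= Z.abs k)%Z).

Definition cells {G : Type} (i : G -> nat -> bool) (m t r : nat) (A : l1 G -> Prop) : Prop :=
  exists c, admissible t r c /\ A = cell i m t r c.

Fixpoint lists_upto {T : Type} (alphabet : list T) (n : nat) : list (list T) :=
  match n with
  | O => nil :: nil
  | S n => nil :: flat_map (fun a => map (cons a) (lists_upto alphabet n)) alphabet
  end.

Lemma in_lists_upto {T : Type} (alphabet : list T) n l :
  (length l <= n)%nat -> incl l alphabet -> In l (lists_upto alphabet n).
Proof.
  revert l; induction n as [|n IH]; intros [|a l] Hn Hi; simpl in *; auto; [lia|].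
  right. apply in_flat_map. exists a; split; [apply Hi; simpl; auto|].
  apply in_map, IH; [lia|]. intros b Hb; apply Hi; simpl; auto.
Qed.

Definition piece {G : Type} (i : G -> nat -> bool) (m : nat) (s : list bool) (g : G) : R :=
  if excluded_middle_informative (prefix i m g = s) then 1 else 0.

Lemma piece_le1 {G : Type} (i : G -> nat -> bool) m s g : Rabs (piece i m s g) <= 1.
Proof.
  unfold piece. destruct (excluded_middle_informative _); rewrite ?Rabs_R1, ?Rabs_R0; lra.
Qed.

(* The sum of [y] over the piece of [g] is about [k / t], so [x] has large mass there; but if
   [S] carries most of [x] and misses [g], that mass is close to the mass of [y] on the piece
   without [g], which is at most [1 / t]. *)
Lemma cell_support {G : Type} (i : G -> nat -> bool) m t r c (S : list G) (x y : l1 G) g k e :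
  (0 < t)%nat -> In (g, k) c -> (6 <= Z.abs k)%Z -> cell i m t r c y ->
  mass_le (fun h => ~ In h S) (proj1_sig x) (/ INR t / 2) ->
  (forall h, In h S -> Rabs (l1_sub y x h) < e) ->
  INR (length S) * e <= / INR t / 2 -> 0 < e <= / INR t / 2 ->
  Rabs (pairing (piece i m (prefix i m g)) y - pairing (piece i m (prefix i m g)) x) < e ->
  In g S.
Proof.
  intros Ht Hc Hk (Hval & Hmass & _) Htail Hnear HSe He Hpair.
  apply NNPP; intros HgS.
  set (phi := piece i m (prefix i m g)) in *.
  assert (Hphi : forall h, Rabs (phi h) <= 1) by (intros; apply piece_le1).
  assert (Hphig : phi g = 1).
  { unfold phi, piece. destruct (excluded_middle_informative _); tauto. }
  assert (Hphi0 : forall h, prefix i m h <> prefix i m g -> phi h = 0).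
  { intros h Hh. unfold phi, piece. destruct (excluded_middle_informative _); tauto. }
  set (eta := / INR t) in *.
  assert (Heta : 0 < eta) by (apply Rinv_0_lt_compat, lt_0_INR; auto).
  specialize (Hval g k Hc).
  specialize (Hmass g (in_map fst _ _ Hc)). simpl in Hmass.
  unfold Rdiv in Hval, Hmass. fold eta in Hval, Hmass.
  assert (Hy : Rabs (pairing phi y - lsum (fun h => phi h * proj1_sig y h) (g :: nil)) <= eta).
  { apply tsum_approx; [apply is_l1_pairing; auto; apply proj2_sig | |].
    - repeat constructor; simpl; tauto.
    - replace eta with (1 * eta + 0) by ring.
      apply (mass_le_split (fun h => prefix i m h = prefix i m g)).
      + apply (mass_le_weaken _ _ _ _ _ _ Hmass); try lra.
        * simpl; intros h [Hh Hp]; split; auto; intros ->; tauto.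
        * auto using Rabs_mult_le1.
      + apply mass_le_zero; [lra|]. intros h [_ Hh]. rewrite Hphi0, Rmult_0_l; auto. }
  simpl in Hy. rewrite Hphig in Hy.
  (* As [S] misses [g], the mass of [x] on the piece within [S] is at most [eta] from [y] plus the
     error [eta / 2]; off [S] it is at most [eta / 2]. *)
  assert (Hx : Rabs (pairing phi x) <= (1 * eta + eta / 2) + eta / 2 + 0).
  { apply tsum_bound.
    apply (mass_le_split (fun h => prefix i m h = prefix i m g)).
    - apply (mass_le_split (fun h => In h S)).
      + apply (mass_le_triang _ _ (proj1_sig y) (l1_sub y x)).
        * apply (mass_le_weaken _ _ _ _ _ _ Hmass); try (intros; lra).
          intros h [[_ Hp] HS]; split; auto; intros ->; tauto.
        * apply (mass_le_weaken _ (fun h => In h S) _ (l1_sub y x) _ (INR (length S) * e));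
            try tauto; try (intros; lra).
          apply mass_le_finite; auto; try lra. intros h Hh; apply Rlt_le; auto.
        * intros h _. eapply Rle_trans; [apply Rabs_mult_le1; auto|].
          replace (proj1_sig x h) with (proj1_sig y h - l1_sub y x h)
            by (unfold l1_sub; ring). apply Rabs_sub_le.
      + apply (mass_le_weaken _ _ _ _ _ _ Htail); try (intros; lra); [tauto|].
        auto using Rabs_mult_le1.
    - apply mass_le_zero; [lra|]. intros h [_ Hh]. rewrite Hphi0, Rmult_0_l; auto. }
  (* So [|y g|] is at least [6 eta - 2 eta] and the sum for [y] at least [3 eta], more than the
     [2 eta + eta / 2] that [x] allows. *)
  assert (Hk6 : 6 * eta <= Rabs (IZR k * eta)).
  { rewrite Rabs_mult, (Rabs_right eta) by lra. apply Rmult_le_compat_r; [lra|].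
    rewrite <- abs_IZR. now apply IZR_le. }
  revert Hval Hy Hx Hpair Hk6. unfold Rabs.
  repeat destruct (Rcase_abs _); lra.
Qed.

(** A cell meeting the neighbourhood built here has a center of length at most [t], with support in
    [S] by [cell_support] and with integers bounded through the norm of [x]; only finitely many
    lists qualify. *)
Lemma cells_locally_finite {G : Type} (i : G -> nat -> bool) m t r :
  locally_finite weak_open (cells i m t r).
Proof.
  intros x.
  (* For [t = 0] no center is admissible and the family is empty. *)
  destruct (le_lt_dec t 0) as [Ht0|Ht].
  { exists (fun _ => True). split.
    - intros y _. exists nil, 1. split; [intros f []|]. split; [lra|auto].
    - split; auto. exists nil. intros A (c & (Hr & Hc & _) & _) _. simpl in *; nia. }
  assert (Heta : 0 < / INR t) by (apply Rinv_0_lt_compat, lt_0_INR; auto).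
  set (eta := / INR t) in *.
  destruct (small_tail (proj1_sig x) (eta / 2) (proj2_sig x)) as (S & _ & HS); [lra|].
  destruct (proj1 (is_l1_mass _) (proj2_sig x)) as [B HB].
  set (l := INR (length S) + 1).
  assert (Hl : 1 <= l) by (unfold l; pose proof (pos_INR (length S)); lra).
  set (e := eta / 2 / l).
  assert (He : 0 < e) by (apply Rdiv_lt_0_compat; lra).
  assert (Hel : l * e = eta / 2) by (unfold e; field; lra).
  set (fs := map (fun s => pairing (piece i m s)) (lists_upto (true :: false :: nil) m)).
  exists (fun y => (forall f, In f fs -> Rabs (f y - f x) < e) /\
                   (forall g, In g S -> Rabs (l1_sub y x g) < e)).
  split; [apply weak_open_and; [apply weak_open_basic|apply weak_open_coords]|].
  { intros f Hf. apply in_map_iff in Hf as (s & <- & _). apply pairing_clf, piece_le1. }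
  split.
  { split; [|intros; now apply l1_sub_self].
    intros f _. unfold Rminus. now rewrite Rplus_opp_r, Rabs_R0. }
  (* [B + 3 eta] bounds [|k| / t]: [B] for [x g], [e <= eta / 2] from [x] to [y], and [2 eta] from
     [y] to [k / t]. *)
  destruct (INR_unbounded ((B + 3 * eta) * INR t)) as [M HM].
  exists (map (cell i m t r) (lists_upto
    (list_prod S (map (fun n => (Z.of_nat n - Z.of_nat M)%Z) (seq 0 (2 * M + 1)))) t)).
  intros A (c & (Hr & Hc & Hk) & ->) (y & (Hfs & Hy) & Hcell).
  apply in_map, in_lists_upto; [nia|].
  intros [g k] Hgk.
  assert (HgS : In g S).
  { eapply (cell_support i m t r c S x y g k e); eauto; fold eta.
    - unfold l in *; nra.
    - split; auto. nra.
    - apply Hfs. apply (in_map (fun s => pairing (piece i m s))), in_lists_upto.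
      + unfold prefix. rewrite length_map, length_seq. lia.
      + intros [|] _; simpl; auto. }
  apply in_prod; auto. apply in_map_iff.
  enough (- Z.of_nat M <= k <= Z.of_nat M)%Z
    by (exists (Z.to_nat (k + Z.of_nat M)); rewrite in_seq; lia).
  apply Z.abs_le, le_IZR. rewrite abs_IZR, <- INR_IZR_INZ.
  apply Rle_trans with ((B + 3 * eta) * INR t); [|lra].
  assert (Ht' : 0 < INR t) by (now apply lt_0_INR).
  assert (E : IZR k = (IZR k * eta) * INR t) by (unfold eta; field; lra).
  rewrite E, Rabs_mult, (Rabs_right (INR t)) by lra.
  apply Rmult_le_compat_r; [lra|].
  assert (Hval := proj1 Hcell g k Hgk). unfold Rdiv in Hval; fold eta in Hval.
  specialize (Hy g HgS). unfold l1_sub in Hy.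
  assert (HxB := mass_le_coord _ _ _ g HB I).
  assert (e <= eta / 2) by nra.
  revert Hval Hy HxB. unfold Rabs. repeat destruct (Rcase_abs _); lra.
Qed.

(** Distinct points of $2^{\mathbb N}$ differ at some digit, and longer prefixes separate at least
    as well, so a maximum over finitely many pairs suffices. *)
Lemma prefix_separates {G : Type} (i : G -> nat -> bool) (l : list G) :
  (forall a b, i a = i b -> a = b) ->
  exists m, forall a b, In a l -> In b l -> prefix i m a = prefix i m b -> a = b.
Proof.
  intros Hi.
  assert (Hmono : forall m n a b, (m <= n)%nat ->
    prefix i n a = prefix i n b -> prefix i m a = prefix i m b).
  { intros m n a b Hmn H. unfold prefix in *. apply map_ext_in. intros j Hj.
    apply in_seq in Hj. apply (proj1 map_ext_in_iff H). apply in_seq; lia. }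
  assert (Hone : forall a (l : list G), exists m, forall b, In b l ->
    prefix i m a = prefix i m b -> a = b).
  { intros a l'. induction l' as [|b l' [m IH]].
    - exists 0%nat; intros b [].
    - destruct (classic (a = b)) as [->|Hab].
      + exists m. intros b' [<-|Hb'] H; auto.
      + assert (exists j, i a j <> i b j) as [j Hj].
        { apply not_all_ex_not. intros H. apply Hab, Hi. now apply functional_extensionality. }
        exists (Nat.max m (S j)). intros b' [<-|Hb'] H.
        * exfalso; apply Hj. unfold prefix in H.
          apply (proj1 map_ext_in_iff H). apply in_seq; lia.
        * apply IH; auto. eapply Hmono; [|exact H]. lia. }
  enough (forall l', incl l' l -> exists m, forall a b, In a l' -> In b l ->
    prefix i m a = prefix i m b -> a = b) as Hall.
  { destruct (Hall l (incl_refl l)) as [m H]; eauto. }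
  induction l' as [|a l' IH]; intros Hincl.
  - exists 0%nat; intros a b [].
  - apply incl_cons_inv in Hincl as [_ Hincl].
    destruct (IH Hincl) as [m H]. destruct (Hone a l) as [n Hn].
    exists (Nat.max m n). intros b b' [<-|Hb] Hb' E.
    + apply Hn; auto. eapply Hmono; [|exact E]; lia.
    + apply H; auto. eapply Hmono; [|exact E]; lia.
Qed.

(** Two vectors of a cell differ by at most [4 / t] at each of at most [t / r] support points, and
    by at most [2 / r] in total outside the support. *)
Lemma cell_diameter {G : Type} (i : G -> nat -> bool) m t r c (x y : l1 G) :
  admissible t r c -> cell i m t r c x -> cell i m t r c y ->
  mass_le (fun _ => True) (l1_sub y x) (6 / INR r).
Proof.
  intros (Hr & Hc & _) (Hx & _ & Hxt) (Hy & _ & Hyt).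
  assert (Hr' : 0 < INR r) by (now apply lt_0_INR).
  assert (Ht' : 0 < INR t) by (apply lt_0_INR; nia).
  assert (Hct : INR (length c) * (4 / INR t) <= 4 / INR r).
  { apply Rmult_le_reg_r with (INR r * INR t); [nra|].
    replace (INR (length c) * (4 / INR t) * (INR r * INR t))
      with (4 * (INR r * INR (length c))) by (field; lra).
    replace (4 / INR r * (INR r * INR t)) with (4 * INR t) by (field; lra).
    rewrite <- mult_INR. apply Rmult_le_compat_l; [lra|]. apply le_INR; nia. }
  assert (0 < / INR t) by (now apply Rinv_0_lt_compat).
  apply (mass_le_weaken _ (fun _ => True) _ (l1_sub y x) _
    (INR (length (map fst c)) * (4 / INR t) + (1 / INR r + 1 / INR r)));
    auto; try (intros; lra).
  - apply (mass_le_split (fun g => In g (map fst c))).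
    + apply mass_le_finite; [unfold Rdiv; lra|tauto|].
      intros g [_ Hg]. apply in_map_iff in Hg as ([g' k] & <- & Hg). simpl.
      specialize (Hx g' k Hg). specialize (Hy g' k Hg). unfold l1_sub.
      replace (proj1_sig y g' - proj1_sig x g') with
        ((proj1_sig y g' - IZR k / INR t) - (proj1_sig x g' - IZR k / INR t)) by ring.
      eapply Rle_trans; [apply Rabs_sub_le|]. lra.
    + apply (mass_le_triang _ _ (proj1_sig y) (proj1_sig x)).
      * apply (mass_le_weaken _ _ _ _ _ _ Hyt); try (intros; lra); tauto.
      * apply (mass_le_weaken _ _ _ _ _ _ Hxt); try (intros; lra); tauto.
      * intros; apply Rabs_sub_le.
  - rewrite length_map. unfold Rdiv in *; lra.
Qed.

(** The choices are made in the order support [F], scale [t], tail set [S'], depth [m]: [S'] depends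
    on [t], and [m] has to separate the points of [F] and [S'] together. *)
Lemma cell_around {G : Type} (i : G -> nat -> bool) (r : nat) (x : l1 G) :
  (forall a b, i a = i b -> a = b) -> (0 < r)%nat ->
  exists m t c, admissible t r c /\ exists rho, 0 < rho /\
    forall y, mass_le (fun _ => True) (l1_sub y x) rho -> cell i m t r c y.
Proof.
  intros Hi Hr.
  assert (Hr' : 0 < INR r) by (now apply lt_0_INR).
  assert (Hrinv : 0 < / INR r) by (now apply Rinv_0_lt_compat).
  destruct (small_tail (proj1_sig x) (/ INR r / 2) (proj2_sig x)) as (S & _ & HS); [lra|].
  (* Coordinates where [x] vanishes are dropped: no scale makes them round to an integer of absolute
     value at least 6. *)
  set (F := select (fun g => proj1_sig x g <> 0) S).
  assert (HF : mass_le (fun g => ~ In g F) (proj1_sig x) (/ INR r / 2 + 0)).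
  { apply (mass_le_split (fun g => ~ In g S)).
    - apply (mass_le_weaken _ _ _ _ _ _ HS); try (intros; lra); tauto.
    - apply mass_le_zero; [lra|]. intros g [Hg HgS]. apply NNPP in HgS.
      apply NNPP; intros H0. apply Hg, in_select; auto. }
  (* The bound is 7 because rounding by [up] changes the value by at most 1. *)
  assert (exists n, forall t, (n <= t)%nat -> forall g, In g F ->
    7 <= Rabs (INR t * proj1_sig x g)) as [n Hn].
  { assert (H0 : forall g, In g F -> proj1_sig x g <> 0)
      by (intros g Hg; now apply in_select in Hg).
    clearbody F. clear HF. induction F as [|g F IH].
    - exists 0%nat; intros t _ g [].
    - destruct IH as [n Hn]; [intros; apply H0; simpl; auto|].
      assert (Hg : 0 < Rabs (proj1_sig x g)) by (apply Rabs_pos_lt, H0; simpl; auto).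
      destruct (INR_unbounded (7 / Rabs (proj1_sig x g))) as [n' Hn'].
      exists (Nat.max n n'). intros t Ht h [<-|Hh]; [|apply Hn; auto; lia].
      rewrite Rabs_mult, (Rabs_right (INR t)) by (apply Rle_ge, pos_INR).
      assert (INR n' <= INR t) by (apply le_INR; lia).
      apply Rle_trans with (7 / Rabs (proj1_sig x g) * Rabs (proj1_sig x g)).
      + right; field; lra.
      + apply Rmult_le_compat_r; lra. }
  set (t := (n + r * (1 + length F))%nat).
  assert (Ht : (0 < t)%nat) by (unfold t; nia).
  assert (Ht' : 0 < INR t) by (now apply lt_0_INR).
  assert (Htinv : 0 < / INR t) by (now apply Rinv_0_lt_compat).
  assert (Htr : / INR t <= / INR r).
  { apply Rinv_le_contravar; auto. apply le_INR. unfold t; nia. }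
  destruct (small_tail (proj1_sig x) (/ INR t / 2) (proj2_sig x)) as (S' & _ & HS'); [lra|].
  destruct (prefix_separates i (F ++ S') Hi) as [m Hm].
  set (c := map (fun g => (g, up (INR t * proj1_sig x g))) F).
  assert (Hc : map fst c = F) by (unfold c; rewrite map_map; apply map_id).
  exists m, t, c. split; [split; [auto|split]|].
  - unfold c. rewrite length_map. unfold t; lia.
  - intros g k Hgk. apply in_map_iff in Hgk as (h & [= -> <-] & Hg).
    apply le_IZR. rewrite abs_IZR.
    destruct (archimed (INR t * proj1_sig x g)) as [H1 H2].
    specialize (Hn t ltac:(unfold t; lia) g Hg).
    revert Hn. unfold Rabs. repeat destruct (Rcase_abs _); lra.
  (* An extra [1 / (2 t)] fits all three tolerances: [1 / t] is spent on rounding, [1 / (2 t)] on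
     the tail beyond [S'], and [1 / (2 r)] on the tail beyond [F], where [r <= t]. *)
  - exists (/ INR t / 2). split; [lra|]. intros y Hy.
    assert (Hyx : forall g, Rabs (proj1_sig y g) <= Rabs (proj1_sig x g) + Rabs (l1_sub y x g)).
    { intros g. replace (proj1_sig y g) with (proj1_sig x g + l1_sub y x g) at 1
        by (unfold l1_sub; ring). apply Rabs_triang. }
    repeat split; rewrite ?Hc.
    + intros g k Hgk. apply in_map_iff in Hgk as (h & [= -> <-] & Hg).
      destruct (archimed (INR t * proj1_sig x g)) as [H1 H2].
      set (k := up (INR t * proj1_sig x g)) in *.
      assert (Hxk : Rabs (proj1_sig x g - IZR k / INR t) <= / INR t).
      { replace (proj1_sig x g - IZR k / INR t)
          with ((INR t * proj1_sig x g - IZR k) * / INR t) by (field; lra).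
        rewrite Rabs_mult, (Rabs_right (/ INR t)) by lra.
        rewrite <- (Rmult_1_l (/ INR t)) at 2. apply Rmult_le_compat_r; [lra|].
        apply Rabs_le; lra. }
      assert (Hg' := mass_le_coord _ _ _ g Hy I). unfold l1_sub in Hg'.
      replace (proj1_sig y g - IZR k / INR t) with
        ((proj1_sig y g - proj1_sig x g) + (proj1_sig x g - IZR k / INR t)) by ring.
      eapply Rle_trans; [apply Rabs_triang|]. unfold Rdiv at 2. lra.
    + intros g Hg. replace (1 / INR t) with (/ INR t / 2 + / INR t / 2) by lra.
      apply (mass_le_triang _ _ (proj1_sig x) (l1_sub y x)); auto.
      * apply (mass_le_weaken _ _ _ _ _ _ HS'); try (intros; lra).
        (* A point of [S'] in the cylinder of [g] would equal [g]. *)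
        intros h [Hh Hne] Hin. apply Hne, Hm; auto; apply in_or_app; auto.
      * apply (mass_le_weaken _ _ _ _ _ _ Hy); auto; intros; lra.
    + apply (mass_le_weaken _ (fun h => ~ In h F) _ (proj1_sig y) _
        (/ INR r / 2 + 0 + / INR t / 2)); auto; try (intros; lra).
      apply (mass_le_triang _ _ (proj1_sig x) (l1_sub y x)); auto.
      apply (mass_le_weaken _ _ _ _ _ _ Hy); auto; intros; lra.
Qed.

Lemma card_aleph_space {G : Type} : card_le_continuum G -> aleph_space (@weak_open G).
Proof.
  intros [i Hi]. split; [apply weak_regular|].
  set (Ns := fun n : nat => let (m, tr) := of_nat n in let (t, r) := of_nat tr in
    @cells G i m t r).
  exists (fun A => exists n, Ns n A). split.
  - exists Ns. split; [|tauto]. intros n. unfold Ns.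
    destruct (of_nat n) as [m tr]. destruct (of_nat tr) as [t r].
    apply cells_locally_finite.
  - intros K U HK HU HKU.
    destruct (weakly_compact_norm_cover K
      (fun A => (exists n, Ns n A) /\ subset A U) HK) as (l & Hl & Hc).
    + intros x Kx.
      destruct (weak_open_norm_ball U x HU (HKU x Kx)) as (d & Hd & HdU).
      (* Cells have diameter at most [6 / r], so [r > 6 / d] keeps a cell containing [x] inside the
         norm ball contained in [U]. *)
      destruct (INR_unbounded (6 / d)) as [r Hr].
      assert (H6 : 0 < 6 / d) by (apply Rdiv_lt_0_compat; lra).
      assert (Hr0 : (0 < r)%nat) by (apply INR_lt; simpl; lra).
      assert (Hrd : 6 / INR r < d).
      { apply Rmult_lt_reg_r with (INR r); [lra|].
        replace (6 / INR r * INR r) with (6 / d * d) by (field; lra).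
        rewrite (Rmult_comm d). apply Rmult_lt_compat_r; lra. }
      destruct (cell_around i r x Hi Hr0) as (m & t & c & Hadm & rho & Hrho & Hcell).
      exists (cell i m t r c), rho. split; [split|]; auto.
      * exists (to_nat (m, to_nat (t, r))). unfold Ns. rewrite !cancel_of_to.
        exists c; auto.
      * intros y Hy. apply HdU, l1norm_lt_mass. exists (6 / INR r); split; auto.
        apply (cell_diameter i m t r c); auto. apply Hcell.
        apply mass_le_zero; [lra|]. intros g _. unfold l1_sub. ring.
    + exists l. split; [|split; auto].
      * intros A HA. now apply Hl.
      * intros y (A & HA & Ay). apply Hl in HA as [_ HA]. auto.
Qed.

Theorem theorem1p2 (Gamma : Type) :
  aleph_space (@weak_open Gamma) <-> card_le_continuum Gamma.
Proof. split; [apply aleph_space_card|apply card_aleph_space]. Qed.
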